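(* Let $(X,\mu,T)$ be a nonsingular dynamical system with $T$ doubly ergodic, and let $d$ be a totally bounded $\mu$-compatible metric on $X$. Then $T$ is Li-Yorke M-sensitive with respect to $d$.
   Context: A nonsingular dynamical system $(X,\mu,T)$ consists of a standard Borel space $X$ with a $\sigma$-finite nonatomic (nonzero) measure $\mu$ and a measurable map $T:X\to X$ such that $\mu(A)=0$ iff $\mu(T^{-1}A)=0$ for measurable $A$. $T$ is doubly ergodic if for all measurable $A,B$ of positive measure there is $n>0$ such that $\mu(A\cap T^{-n}A)>0$ and $\mu(A\cap T^{-n}B)>0$ (an iterate of $A$ meets both $A$ and $B$ in positive measure). All metrics $d$ on $X$ are assumed Borel measurable on $X\times X$ and bounded by $1$. A metric $d$ is $\mu$-compatible if every nonempty open $d$-ball has positive $\mu$-measure. A pair $(x,y)$ is a Li-Yorke pair for $d$ if $\liminf_{n\to\infty}d(T^nx,T^ny)=0$ and $\limsup_{n\to\infty}d(T^nx,T^ny)>0$. $T$ is Li-Yorke M-sensitive with respect to $d$ if the set of Li-Yorke pairs for $d$ has full $\mu\times\mu$-measure in $X\times X$. *)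

(* Defs.v *)
From HB Require Import structures.
From mathcomp Require Import all_boot all_order all_algebra.
From mathcomp Require Import all_classical all_reals all_analysis.

Set Implicit Arguments.
Unset Strict Implicit.
Unset Printing Implicit Defensive.

Import Order.TTheory GRing.Theory Num.Theory.
Import numFieldNormedType.Exports.

Local Open Scope classical_set_scope.
Local Open Scope ring_scope.

(* The measurable sets of [X] are the Borel sets of some Polish (separable
   completely metrizable) topology, transported along a bijection.  A Hausdorff
   pseudometric is a metric. *)
Definition standard_borel (R : realType) (disp : measure_display)
    (X : measurableType disp) : Prop :=
  exists (P : completePseudoMetricType R) (f : X -> P),
    [/\ hausdorff_space P,
        exists2 D : set P, countable D & dense D,
        bijective f &
        forall A : set X,
          measurable A <-> exists2 B : set P, <<s open >> B & A = f @^-1` B].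

Section Dynamics.
Context (R : realType) (disp : measure_display) (X : measurableType disp).
Implicit Types (mu : {sigma_finite_measure set X -> \bar R}) (T : X -> X).

Definition nonatomic mu : Prop :=
  forall A : set X, measurable A -> (0 < mu A)%E ->
    exists B : set X,
      [/\ measurable B, B `<=` A, (0 < mu B)%E & (mu B < mu A)%E].

Record nonsingular_system mu T : Prop := {
  nss_standard_borel : standard_borel R X;
  nss_nonatomic : nonatomic mu;
  nss_nonzero : (0 < mu [set: X])%E;
  nss_measurable : measurable_fun [set: X] T;
  nss_nonsingular : forall A : set X, measurable A ->
    (mu A = 0%E <-> mu (T @^-1` A) = 0%E)
}.

Definition doubly_ergodic mu T : Prop :=
  forall A B : set X, measurable A -> measurable B ->
    (0 < mu A)%E -> (0 < mu B)%E ->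
    exists n : nat,
      [/\ (0 < n)%N,
          (0 < mu (A `&` (iter n T) @^-1` A))%E &
          (0 < mu (A `&` (iter n T) @^-1` B))%E].

End Dynamics.

(* A metric is kept as a bare function rather than a [metricType] structure,
   since the sigma-algebra of [X] need not be the Borel one of the metric. *)
Section Metrics.
Context (R : realType) (X : Type).
Implicit Types (dist : X -> X -> R).

Record is_metric dist : Prop := {
  dist_ge0 : forall x y, 0 <= dist x y;
  dist_eq0 : forall x y, dist x y = 0 <-> x = y;
  dist_sym : forall x y, dist x y = dist y x;
  dist_triangle : forall x y z, dist x z <= dist x y + dist y z
}.

Definition dist_ball dist (x : X) (e : R) : set X := [set y | dist x y < e].

Definition dist_totally_bounded dist : Prop :=
  forall e : R, 0 < e ->
    exists2 F : set X, finite_set F & \bigcup_(x in F) dist_ball dist x e = setT.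

Definition li_yorke_pair dist (T : X -> X) (p : X * X) : Prop :=
  let u (n : nat) : \bar R := (dist (iter n T p.1) (iter n T p.2))%:E in
  limn_einf u = 0%E /\ (0 < limn_esup u)%E.

End Metrics.

Section MeasurableMetrics.
Context (R : realType) (disp : measure_display) (X : measurableType disp).
Implicit Types (mu : {sigma_finite_measure set X -> \bar R}) (T : X -> X)
  (dist : X -> X -> R).

Record borel_metric dist : Prop := {
  borel_metric_metric : is_metric dist;
  borel_metric_measurable :
    measurable_fun [set: X * X] (fun p : X * X => dist p.1 p.2);
  borel_metric_le1 : forall x y, dist x y <= 1
}.

Definition compatible_metric mu dist : Prop :=
  forall (x : X) (e : R), dist_ball dist x e !=set0 ->
    (0 < mu (dist_ball dist x e))%E.

Definition li_yorke_M_sensitive mu T dist : Prop :=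
  {ae (mu \x mu)%E, forall p : X * X, li_yorke_pair dist T p}.

End MeasurableMetrics.

(* Main.v *)
(* Write N(A, B) for the set of n with mu (A `&` T^-n B) > 0.  Double ergodicity
   makes the sets N(A, B) a filter base (as in Furstenberg's intersection lemma
   for topological weak mixing), so a set A of positive measure visits finitely
   many sets of positive measure simultaneously, at an arbitrarily large time.
   Fix x.
   - If {y : d (T^n x) (T^n y) >= e for all n >= m} had positive measure, at
     some time n >= m it would visit every ball of a finite cover by e/2-balls, in
     particular one that contains T^n x and so is within e of T^n x.
   - If {y : d (T^n x) (T^n y) < r for all n >= m} had positive measure, at some
     time n >= m it would visit two r-balls with centers at distance 4r, while
     its image under T^n has diameter at most 2r.
   Hence both sets are null for every x, and Fubini concludes. *)
Require Import Defs.
From mathcomp Require Import all_boot all_order all_algebra.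
From mathcomp Require Import all_classical all_reals all_analysis.
From mathcomp Require Import lra.

Set Implicit Arguments.
Unset Strict Implicit.
Unset Printing Implicit Defensive.

Import Order.TTheory GRing.Theory Num.Theory.
Import numFieldNormedType.Exports.

Local Open Scope classical_set_scope.
Local Open Scope ring_scope.

(** * Iterates of a nonsingular map and visit times *)

Section VisitTimes.
Context (R : realType) (disp : measure_display) (X : measurableType disp).
Context (mu : {sigma_finite_measure set X -> \bar R}) (T : X -> X).
Context (hsys : nonsingular_system mu T).

Lemma measurable_iter n : measurable_fun [set: X] (iter n T).
Proof.
elim: n => [|n IH] /=; first exact: measurable_id.
exact: measurableT_comp (nss_measurable hsys) IH.
Qed.

Lemma measurable_iter_preimage n (A : set X) :
  measurable A -> measurable (iter n T @^-1` A).
Proof.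
by move=> mA; rewrite -[_ @^-1` _]setTI; exact: measurable_iter.
Qed.

Lemma measure_preimage_gt0 (A : set X) : measurable A ->
  (0 < mu (T @^-1` A))%E = (0 < mu A)%E.
Proof.
move=> mA; rewrite !lt0e !measure_ge0 !andbT; congr (~~ _).
by apply/eqP/eqP => /(nss_nonsingular hsys mA).
Qed.

Lemma measure_iter_preimage_gt0 n (A : set X) : measurable A ->
  (0 < mu (iter n T @^-1` A))%E = (0 < mu A)%E.
Proof.
move=> mA; elim: n => [//|n IH].
have -> : iter n.+1 T @^-1` A = T @^-1` (iter n T @^-1` A).
  by apply/funext => x /=; rewrite -iterS iterSr.
by rewrite measure_preimage_gt0//; exact: measurable_iter_preimage.
Qed.

Lemma iter_preimageD m n (A : set X) :
  iter m T @^-1` (iter n T @^-1` A) = iter (m + n) T @^-1` A.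
Proof. by apply/funext => x /=; rewrite addnC iterD. Qed.

Definition visits (A B : set X) (n : nat) : Prop :=
  (0 < mu (A `&` iter n T @^-1` B))%E.

Lemma measurable_visit (A B : set X) n : measurable A -> measurable B ->
  measurable (A `&` iter n T @^-1` B).
Proof.
by move=> mA mB; apply: measurableI => //; exact: measurable_iter_preimage.
Qed.

Lemma visitsS (A B C D : set X) k n :
  measurable A -> measurable B -> measurable C -> measurable D ->
  A `<=` C -> A `&` iter n T @^-1` B `<=` iter k T @^-1` D ->
  visits A B n -> visits C D k.
Proof.
move=> mA mB mC mD AC ABD /lt_le_trans; apply; apply: le_measure.
- by rewrite inE; exact: measurable_visit.
- by rewrite inE; exact: measurable_visit.
- by move=> x ABx; split; [apply: AC; case: ABx|exact: ABD].
Qed.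

(** * Intersections of sets of visit times *)

Context (hde : doubly_ergodic mu T).

(** Let [G] be the part of [U] that reaches [V] at time [a]. Double ergodicity applied to [G] and
    the pullback of [W] under [iter a T] gives [n] at which [G] returns to itself and meets that
    pullback. The return puts [V], and the pullback puts [W], at time [n + a]. *)
Lemma visits_common_source (U V W : set X) :
  measurable U -> measurable V -> measurable W ->
  (0 < mu U)%E -> (0 < mu V)%E -> (0 < mu W)%E ->
  exists n, visits U V n /\ visits U W n.
Proof.
move=> mU mV mW U0 V0 W0.
have [a [_ _ Ga]] := hde mU mV U0 V0.
set G := U `&` iter a T @^-1` V in Ga.
have mG : measurable G by exact: measurable_visit.
have mH : measurable (iter a T @^-1` W) by exact: measurable_iter_preimage.
have H0 : (0 < mu (iter a T @^-1` W))%E by rewrite measure_iter_preimage_gt0.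
have [n [_ GG GH]] := hde mG mH Ga H0.
exists (n + a)%N; split.
- apply: (visitsS mG mG mU mV _ _ GG) => [x []//|].
  by rewrite -iter_preimageD => x [_ []].
- apply: (visitsS mG mH mU mW _ _ GH) => [x []//|].
  by rewrite -iter_preimageD => x [].
Qed.

(** The two sources are merged into one: [E] is the part of [A] that lies in [C] after [a] steps. It
    is sent to [B] and to the pullback of [D] at a common time. The second visit lies in the
    pullback of [C] meeting [D], and nonsingularity removes that pullback. *)
Lemma visits_common_time (A B C D : set X) :
  measurable A -> measurable B -> measurable C -> measurable D ->
  (0 < mu A)%E -> (0 < mu B)%E -> (0 < mu C)%E -> (0 < mu D)%E ->
  exists n, visits A B n /\ visits C D n.
Proof.
move=> mA mB mC mD A0 B0 C0 D0.
have [a [_ _ Ea]] := hde mA mC A0 C0.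
set E := A `&` iter a T @^-1` C in Ea.
have mE : measurable E by exact: measurable_visit.
have mD' : measurable (iter a T @^-1` D) by exact: measurable_iter_preimage.
have D'0 : (0 < mu (iter a T @^-1` D))%E by rewrite measure_iter_preimage_gt0.
have [n [EB ED]] := visits_common_source mE mB mD' Ea B0 D'0.
exists n; split; first by apply: (visitsS mE mB mA mB _ _ EB) => x [].
rewrite /visits -(measure_iter_preimage_gt0 a); last exact: measurable_visit.
apply: lt_le_trans ED _; apply: le_measure.
- by rewrite inE; exact: measurable_visit.
- by rewrite inE; apply: measurable_iter_preimage; exact: measurable_visit.
- rewrite preimage_setI !iter_preimageD addnC => x [[_ Cx] Dx].
  by split.
Qed.

(** Choose [m] at which [A] visits [C] and [B] visits [D], and cut [A] and [B] down to the points
    doing so. A point going from [E] to [F] in [n] steps goes from [A] to [B], and its image under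
    [iter m T] goes from [C] to [D], also in [n] steps. *)
Lemma visits_filter_base (A B C D : set X) :
  measurable A -> measurable B -> measurable C -> measurable D ->
  (0 < mu A)%E -> (0 < mu B)%E -> (0 < mu C)%E -> (0 < mu D)%E ->
  exists E F, [/\ measurable E, measurable F, (0 < mu E)%E, (0 < mu F)%E &
    forall n, visits E F n -> visits A B n /\ visits C D n].
Proof.
move=> mA mB mC mD A0 B0 C0 D0.
have [m []] := visits_common_time mA mC mB mD A0 C0 B0 D0.
rewrite /visits => E0 F0.
set E := A `&` iter m T @^-1` C in E0; set F := B `&` iter m T @^-1` D in F0.
have mE : measurable E by exact: measurable_visit.
have mF : measurable F by exact: measurable_visit.
exists E, F; split => // n EF; split.
  by apply: (visitsS mE mF mA mB _ _ EF) => x []// _ [].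
rewrite /visits -(measure_iter_preimage_gt0 m); last exact: measurable_visit.
apply: lt_le_trans EF _; apply: le_measure.
- by rewrite inE; exact: measurable_visit.
- by rewrite inE; apply: measurable_iter_preimage; exact: measurable_visit.
- rewrite /F !preimage_setI !iter_preimageD addnC => x [[_ Cx] [_ Dx]].
  by split.
Qed.

Lemma visits_seq (I : eqType) (A : set X) (B : I -> set X) (s : seq I)
    (m : nat) :
  measurable A -> (0 < mu A)%E ->
  (forall i, measurable (B i)) -> (forall i, (0 < mu (B i))%E) ->
  exists2 n, (m <= n)%N & {in s, forall i, visits A (B i) n}.
Proof.
move=> mA A0 mB B0.
(* Double ergodicity only yields a positive time. Pulling every target back by [m] steps shifts the
   visit time by [m], which gives the bound [m <= n]. *)
suff [E [F [mE mF E0 F0 EF]]] : exists E F, [/\ measurable E, measurable F,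
    (0 < mu E)%E, (0 < mu F)%E & forall n, visits E F n ->
    {in s, forall i, visits A (iter m T @^-1` B i) n}].
  have [n [_ _ /EF AB]] := hde mE mF E0 F0.
  exists (n + m)%N => [|i /AB]; first exact: leq_addl.
  by rewrite /visits iter_preimageD.
elim: s => [|i s [E [F [mE mF E0 F0 EF]]]]; first by exists A, A.
have mB' : measurable (iter m T @^-1` B i) by exact: measurable_iter_preimage.
have B'0 : (0 < mu (iter m T @^-1` B i))%E by rewrite measure_iter_preimage_gt0.
have [E' [F' [mE' mF' E'0 F'0 EF']]] :=
  visits_filter_base mA mB' mE mF A0 B'0 E0 F0.
exists E', F'; split => // n /EF'[AB /EF ABs] j.
by rewrite inE => /predU1P[->|/ABs].
Qed.

Lemma visits_ex (A B : set X) n : visits A B n ->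
  exists2 x, A x & B (iter n T x).
Proof.
move=> AB; suff /set0P[x [Ax Bx]] : A `&` iter n T @^-1` B != set0 by exists x.
by apply: contraPneq AB => AB0; rewrite /visits AB0 measure0 ltxx.
Qed.

End VisitTimes.

(** * Distances along pairs of orbits *)

Section BorelMetric.
Context (R : realType) (disp : measure_display) (X : measurableType disp).
Context (mu : {sigma_finite_measure set X -> \bar R}) (T : X -> X).
Context (d : X -> X -> R).
Context (hsys : nonsingular_system mu T) (hde : doubly_ergodic mu T).
Context (hd : borel_metric d) (hcomp : compatible_metric mu d).
Let hm : is_metric d := borel_metric_metric hd.

Lemma dist_gt0 x y : x != y -> 0 < d x y.
Proof.
rewrite lt0r (dist_ge0 hm) andbT.
by apply: contra => /eqP/(dist_eq0 hm)/eqP.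
Qed.

Lemma measurable_dist_ball x e : measurable (dist_ball d x e).
Proof.
have mdx : measurable_fun [set: X] (d x).
  exact: measurableT_comp (borel_metric_measurable hd) (pair1_measurable x).
have -> : dist_ball d x e = [set: X] `&` d x @^-1` `]-oo, e[.
  by rewrite setTI; apply/funext => y; rewrite /dist_ball /= in_itv.
by apply: mdx => //; exact: measurable_itv.
Qed.

Lemma dist_ball_gt0 x e : 0 < e -> (0 < mu (dist_ball d x e))%E.
Proof.
move=> e0; apply: hcomp; exists x.
by rewrite /dist_ball /= (dist_eq0 hm x x).2.
Qed.

(** The interval parameter lets the far and the close pairs share one measurability proof. *)
Definition eventually_dist_in (I : interval R) (m : nat) : set (X * X) :=
  \bigcap_(n in [set n | (m <= n)%N])
    [set p | d (iter n T p.1) (iter n T p.2) \in I].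

Lemma measurable_eventually_dist_in I m : measurable (eventually_dist_in I m).
Proof.
apply: bigcap_measurable => [|n _]; first by exists m => /=.
have mT k : measurable_fun [set: X] (iter k T) by exact: measurable_iter hsys k.
have mf : measurable_fun [set: X * X]
    (fun p : X * X => d (iter n T p.1) (iter n T p.2)).
  apply: (measurableT_comp (borel_metric_measurable hd)
    (g := fun p : X * X => (iter n T p.1, iter n T p.2))).
  by apply: measurable_fun_pair; apply: measurableT_comp => //.
rewrite -[X in measurable X]setTI.
have := mf measurableT _ (measurable_itv I).
by rewrite /preimage.
Qed.

Lemma eventually_far_section_null x e m : dist_totally_bounded d -> 0 < e ->
  mu (xsection (eventually_dist_in `[e, +oo[ m) x) = 0%E.
Proof.
move=> htb e0; set S := xsection _ _.
have mS : measurable S.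
  by apply: measurable_xsection; exact: measurable_eventually_dist_in.
apply/eqP; rewrite -[_ == _]negbK; apply/negP => S_neq0.
have S0 : (0 < mu S)%E by rewrite lt0e S_neq0 measure_ge0.
have e20 : 0 < e / 2 by rewrite divr_gt0.
have [F /finite_seqP[s ->] cover] := htb _ e20.
have [n mn visit] := visits_seq hsys hde s m mS S0
  (fun c => measurable_dist_ball c (e / 2)) (fun c => dist_ball_gt0 c e20).
(* The center [c] near [iter n T x] depends on [n], which is why all balls of the cover had to be
   visited at the same time. *)
have [c /= cs cx] :
    (\bigcup_(c in [set` s]) dist_ball d c (e / 2)) (iter n T x).
  by rewrite cover.
have [y /xsectionP Sy cy] := visits_ex (visit c cs).
have := Sy n mn; rewrite /= in_itv /= andbT leNgt => /negP; apply.
have := dist_triangle hm (iter n T x) c (iter n T y).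
rewrite (dist_sym hm _ c); move: cx cy; rewrite /dist_ball /=; lra.
Qed.

Lemma eventually_close_section_null x a b m : a != b ->
  mu (xsection (eventually_dist_in `]-oo, d a b / 4[ m) x) = 0%E.
Proof.
move=> ab; set S := xsection _ _.
have r0 : 0 < d a b / 4 by rewrite divr_gt0 ?dist_gt0.
have mS : measurable S.
  by apply: measurable_xsection; exact: measurable_eventually_dist_in.
apply/eqP; rewrite -[_ == _]negbK; apply/negP => S_neq0.
have S0 : (0 < mu S)%E by rewrite lt0e S_neq0 measure_ge0.
have [n mn visit] := visits_seq hsys hde [:: a; b] m mS S0
  (fun c => measurable_dist_ball c (d a b / 4)) (fun c => dist_ball_gt0 c r0).
have [|y /xsectionP Sy ay] := visits_ex (visit a _); first by rewrite !inE eqxx.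
have [|z /xsectionP Sz bz] := visits_ex (visit b _).
  by rewrite !inE eqxx orbT.
move: (Sy n mn) (Sz n mn) ay bz; rewrite /dist_ball /= !in_itv /=.
(* The path from [a] to [b] through the images of [y], [x] and [z] has four legs, each shorter than
   [d a b / 4]. *)
have := dist_triangle hm a (iter n T y) b.
have := dist_triangle hm (iter n T y) (iter n T x) b.
have := dist_triangle hm (iter n T x) (iter n T z) b.
rewrite (dist_sym hm (iter n T y) (iter n T x)) (dist_sym hm (iter n T z) b).
lra.
Qed.

(** The product measure is by definition the integral of the measures of the sections at [x]. *)
Lemma product_measure1_eq0 (E : set (X * X)) :
  (forall x, mu (xsection E x) = 0%E) -> (mu \x mu)%E E = 0%E.
Proof. by move=> E0; apply: integral0_eq => x _ /=; exact: E0. Qed.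

(** Nonatomicity splits the space: a set of positive but strictly smaller measure is neither empty
    nor everything. The distance between the two points bounds the limsup from below. *)
Lemma nonatomic_two_points : exists a b : X, a != b.
Proof.
have [B [mB _ B0 BX]] := nss_nonatomic hsys measurableT (nss_nonzero hsys).
have [a Ba] : B !=set0.
  by apply/set0P; apply: contraPneq B0 => ->; rewrite measure0 ltxx.
have [b nBb] : ~` B !=set0.
  apply/set0P; apply: contraPneq BX => /(congr1 setC).
  by rewrite setCK setC0 => ->; rewrite ltxx.
by exists a, b; apply: contra_notN nBb => /eqP <-.
Qed.

Lemma li_yorke_pair_not_eventually (p : X * X) (r : R) : 0 < r ->
  (forall k m, ~ eventually_dist_in `[k.+1%:R^-1, +oo[ m p) ->
  (forall m, ~ eventually_dist_in `]-oo, r[ m p) ->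
  li_yorke_pair d T p.
Proof.
move=> r0 far close.
rewrite /li_yorke_pair; set u := (fun n => _%:E); split.
- apply/eqP; rewrite eq_le; apply/andP; split.
  + apply/lee_addgt0Pr => e e0; rewrite add0e.
    have [k] := ltr_add_invr e0; rewrite add0r => ke.
    rewrite limn_einf_lim; apply: lime_le; first exact: is_cvg_einfs.
    apply: nearW => m.
    (* Each tail contains a time with distance below [k.+1%:R^-1], so each tail infimum is at most
       [e]. *)
    have /existsNP[n /not_implyP[mn]] := far k m.
    rewrite /= in_itv /= andbT => /negP; rewrite -ltNge => dk.
    apply: le_trans (_ : (u n <= _)%E).
      by apply: ereal_inf_lbound; exists n.
    by rewrite lee_fin ltW// (lt_trans dk).
  + rewrite limn_einf_lim; apply: lime_ge; first exact: is_cvg_einfs.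
    apply: nearW => m; apply: le_ereal_inf_tmp => _ [n _ <-].
    by rewrite lee_fin (dist_ge0 hm).
- apply: (@lt_le_trans _ _ r%:E); first by rewrite lte_fin.
  rewrite limn_esup_lim; apply: lime_ge; first exact: is_cvg_esups.
  apply: nearW => m.
  (* Each tail contains a time with distance at least [r], so each tail supremum is at least [r]. *)
  have /existsNP[n /not_implyP[mn]] := close m.
  rewrite /= in_itv /= => /negP; rewrite -leNgt => dr.
  apply: (@le_trans _ _ (u n)); first by rewrite lee_fin.
  by apply: ereal_sup_ubound; exists n.
Qed.

End BorelMetric.

Theorem corollary3p5 (R : realType) (disp : measure_display)
    (X : measurableType disp)
    (mu : {sigma_finite_measure set X -> \bar R}%R) (T : X -> X)
    (d : X -> X -> R)
    (hsys : nonsingular_system mu T)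
    (hde : doubly_ergodic mu T)
    (hd : borel_metric d)
    (htb : dist_totally_bounded d)
    (hcomp : compatible_metric mu d) :
  li_yorke_M_sensitive mu T d.
Proof.
have [a [b ab]] := nonatomic_two_points hsys.
have r0 : 0 < d a b / 4 by rewrite divr_gt0// (dist_gt0 hd).
pose far k m := eventually_dist_in T d `[k.+1%:R^-1, +oo[ m.
pose close m := eventually_dist_in T d `]-oo, d a b / 4[ m.
have null (E : set (X * X)) : measurable E ->
    (forall x, mu (xsection E x) = 0%E) -> (mu \x mu)%E.-negligible E.
  by move=> mE E0; exists E; split => //; exact: product_measure1_eq0.
have mdI I m := measurable_eventually_dist_in hsys hd I m.
(* Thresholds [k.+1%:R^-1] keep the union countable; on the close side the single radius [d a b / 4]
   serves all pairs. *)
apply: (@negligibleS _ _ _ _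
  (\bigcup_k \bigcup_m far k m `|` \bigcup_m close m)).
  move=> [x y] /= np; apply: contrapT => nfc; apply: np.
  apply: (@li_yorke_pair_not_eventually _ _ _ T d hd (x, y) _ r0)
    => [k m fp|m cp]; apply: nfc.
    by left; exists k => //; exists m.
  by right; exists m.
apply: negligibleU; apply: negligible_bigcup => k.
- apply: negligible_bigcup => m; apply: null; first exact: mdI.
  by move=> x; apply: eventually_far_section_null => //; rewrite invr_gt0.
- apply: null; first exact: mdI.
  by move=> x; exact: eventually_close_section_null.
Qed.
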